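(* Let $\mathcal{D}=\{x_1,\dots,x_N\}\subseteq X$ be a dataset, let an LSH family on $X$ with hash values in $\{1,\dots,r\}$ and collision probability $p(\cdot,\cdot)$ be given, let $q\in X$ be a query and $v\ge1$, and index the points so that $p_1\ge\dots\ge p_N$ with $p_i=p(x_i,q)$, where $0<p_{v+1}<p_v<1$. Let $\Delta=p_{v+1}/p_v$ and $$b_1=\frac{6|\log p_v|+2\log r}{\log\frac1\Delta},\qquad b_2=\frac{2|\log p_v|}{\log\frac1\Delta}.$$ Then for any $\delta\in(0,1)$ one can construct (in one pass over $\mathcal{D}$) a sketch of size $$O\!\left(v^3N^{b_1}\log\!\left(\frac v\delta N^{b_2}\log\frac N\delta\right)\log\frac N\delta\,\log N\right)$$ bits that solves the exact $v$-nearest neighbor problem for $q$ with probability $1-\delta$, i.e. it reports a set of $v$ indices containing each of the $v$ nearest neighbors $x_1,\dots,x_v$ of $q$ with probability at least $1-\delta$.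
   Context: An LSH family on $X$ is a distribution over functions $l:X\to\{1,\dots,r\}$ with collision probability $p(x,q)=\Pr_l[l(x)=l(q)]$, assumed to be a monotone increasing function of the similarity of $x$ and $q$, so the nearest neighbors of $q$ are the points with largest collision probability. The sketch is the RACE-CMS sketch: for an integer $K$, $L=(l_1,\dots,l_K)$ with independent $l_j$; an ACE array with coefficients $c\in[-1,1]^N$ is $A[j]=\sum_i c_i\mathbf{1}\{L(x_i)=j\}$ over the $r^K$ possible values $j$ of $L$, each counter using $O(\log N)$ bits. A Count-Min Sketch with $d$ independent 2-universal hashes $h_a:\{1,\dots,N\}\to\{1,\dots,w\}$ has cells $C[a,b]=\sum_{i:h_a(i)=b}p(x_i,q)^K$; each cell is estimated by the median of means of independent ACE arrays with coefficients $c_i=\mathbf{1}\{h_a(i)=b\}$ queried at $L(q)$, the estimate $\hat s_i=\min_a\hat C[a,h_a(i)]$ is formed, and the indices of the $v$ largest $\hat s_i$ are reported. The parameters ($K$, $d$, $w$, repetitions) may depend on $N,r,v,\delta,p_v,\Delta$. *)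

(* Defs.v *)
(* MathComp-Analysis. *)
From HB Require Import structures.
From mathcomp Require Import all_boot all_order all_algebra.
From mathcomp Require Import all_classical all_reals all_analysis.
Set Implicit Arguments.
Unset Strict Implicit.
Unset Printing Implicit Defensive.
Import Order.TTheory GRing.Theory Num.Theory.
Local Open Scope classical_set_scope.
Local Open Scope ring_scope.

(* A distribution over functions X -> 'I_r is given by a probability space
   (T, mu) of seeds together with a map l : T -> X -> 'I_r; drawing l from the
   distribution means drawing a seed t from mu and using l t. *)
Definition collision_prob (R : realType) (dT : measure_display)
    (T : measurableType dT) (mu : probability T R) (A B : Type)
    (l : T -> A -> B) (x y : A) : R :=
  fine (mu [set t | l t x = l t y]).

Record is_lsh_family (R : realType) (dT : measure_display)
    (T : measurableType dT) (mu : probability T R) (X : Type) (r : nat)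
    (sim : X -> X -> R) (l : T -> X -> 'I_r) : Prop := IsLshFamily {
  lsh_measurable : forall (x : X) (j : 'I_r), measurable [set t | l t x = j];
  lsh_monotone : exists phi : R -> R, {homo phi : s t / s <= t} /\
    forall x y : X, collision_prob mu l x y = phi (sim x y) }.

Record is_2universal (R : realType) (dS : measure_display)
    (S : measurableType dS) (nu : probability S R) (N w : nat)
    (h : S -> 'I_N -> 'I_w) : Prop := Is2Universal {
  hash_measurable : forall (i : 'I_N) (b : 'I_w), measurable [set s | h s i = b];
  hash_collision : forall i j : 'I_N, i != j ->
    collision_prob nu h i j <= w%:R^-1 }.

(* The random elements z_i (i : I) and u_j (j : J) are mutually independent,
   each z_i has law mu and each u_j has law nu. *)
Record iid_seeds (R : realType) (dO dT dS : measure_display)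
    (Omega : measurableType dO) (T : measurableType dT) (S : measurableType dS)
    (P : probability Omega R) (mu : probability T R) (nu : probability S R)
    (I J : finType) (z : I -> Omega -> T) (u : J -> Omega -> S) : Prop :=
  IidSeeds {
  iid_measurable_l : forall i, measurable_fun [set: Omega] (z i);
  iid_measurable_r : forall j, measurable_fun [set: Omega] (u j);
  iid_law : forall (A : I -> set T) (B : J -> set S),
    (forall i, measurable (A i)) -> (forall j, measurable (B j)) ->
    P [set o | (forall i, A i (z i o)) /\ (forall j, B j (u j o))] =
      ((\prod_(i : I) fine (mu (A i))) *
       (\prod_(j : J) fine (nu (B j))))%:E }.

(* With an even number of entries, the average of the two middle ones. *)
Definition median (R : realType) (s : seq R) : R :=
  let s' := sort <=%O s in
  (nth 0 s' (size s).-1./2 + nth 0 s' (size s)./2) / 2.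

Definition seq_min (R : realType) (s : seq R) : R :=
  \big[Num.min/head 0 s]_(y <- s) y.

Definition lsh_tuple (X : Type) (r K : nat) (l : 'I_K -> X -> 'I_r) (x : X) :
  {ffun 'I_K -> 'I_r} := [ffun k => l k x].

(* ACE array of a stream s of indexed points (i, x_i), with coefficients c. *)
Definition ace (R : realType) (X : Type) (N r K : nat) (c : 'I_N -> R)
    (L : X -> {ffun 'I_K -> 'I_r}) (s : seq ('I_N * X)) :
    {ffun {ffun 'I_K -> 'I_r} -> R} :=
  [ffun j => \sum_(e <- s) c e.1 * (L e.2 == j)%:R].

(* Each Count-Min cell is estimated by the median, over race_groups groups, of
   the mean of race_means independent ACE arrays, each of which uses the
   concatenation of race_K LSH functions. *)
Record race_params := RaceParams {
  race_K : nat;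
  race_rows : nat;
  race_width : nat;
  race_groups : nat;
  race_means : nat }.

Definition race_params_pos (prm : race_params) : bool :=
  [&& (0 < race_K prm)%N, (0 < race_rows prm)%N, (0 < race_width prm)%N,
      (0 < race_groups prm)%N & (0 < race_means prm)%N].

(* (a, b, t, k): k-th ACE array of the t-th group of the Count-Min cell (a, b). *)
Definition race_arr (prm : race_params) : finType :=
  ('I_(race_rows prm) * 'I_(race_width prm) *
   'I_(race_groups prm) * 'I_(race_means prm))%type.

(* Every ACE array draws its own race_K LSH functions. *)
Definition race_idx (prm : race_params) : finType :=
  (race_arr prm * 'I_(race_K prm))%type.

Definition race_counters (R : realType) (r : nat) (prm : race_params) : Type :=
  {ffun race_arr prm -> {ffun {ffun 'I_(race_K prm) -> 'I_r} -> R}}.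

Definition race_cms (R : realType) (X : Type) (N r : nat) (prm : race_params)
    (l : race_idx prm -> X -> 'I_r)
    (h : 'I_(race_rows prm) -> 'I_N -> 'I_(race_width prm))
    (s : seq ('I_N * X)) : race_counters R r prm :=
  [ffun e : race_arr prm =>
    let: (a, b, _, _) := e in
    ace (fun i => (h a i == b)%:R) (lsh_tuple (fun k => l (e, k))) s].

Definition race_stream (X : Type) (N : nat) (x : 'I_N -> X) : seq ('I_N * X) :=
  [seq (i, x i) | i <- enum 'I_N].

(* The sketch of a longer stream is computable from the sketch of its prefix and
   the new element only. *)
Definition one_pass (E St : Type) (sk : seq E -> St) : Prop :=
  exists update : St -> E -> St,
    forall (s : seq E) (e : E), sk (rcons s e) = update (sk s) e.

Definition race_cell (R : realType) (X : Type) (r : nat) (prm : race_params)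
    (l : race_idx prm -> X -> 'I_r) (A : race_counters R r prm) (q : X)
    (a : 'I_(race_rows prm)) (b : 'I_(race_width prm)) : R :=
  median [seq (\sum_(k < race_means prm)
                 A (a, b, t, k) (lsh_tuple (fun j => l ((a, b, t, k), j)) q))
              / (race_means prm)%:R
         | t <- enum 'I_(race_groups prm)].

Definition race_score (R : realType) (X : Type) (N r : nat) (prm : race_params)
    (l : race_idx prm -> X -> 'I_r)
    (h : 'I_(race_rows prm) -> 'I_N -> 'I_(race_width prm))
    (A : race_counters R r prm) (q : X) (i : 'I_N) : R :=
  seq_min [seq race_cell l A q a (h a i) | a <- enum 'I_(race_rows prm)].

(* S can be reported as the indices of the v largest scores; when scores tie
   there are several such S. *)
Definition top_set (R : realType) (N : nat) (v : nat) (score : 'I_N -> R)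
    (S : {set 'I_N}) : Prop :=
  #|S| = v /\ forall i j, i \in S -> j \notin S -> score j <= score i.

(* x_i is among the v nearest when fewer than v points are strictly more
   similar to q. *)
Definition nearest (R : realType) (X : Type) (N : nat) (sim : X -> X -> R)
    (x : 'I_N -> X) (q : X) (v : nat) : {set 'I_N} :=
  [set i | (#|[set j | (sim (x i) q < sim (x j) q)%R]%SET| < v)%N]%SET.

(* The counters take integer values in 0..N, hence up_log 2 N.+1 bits each. *)
Definition race_bits (N r : nat) (prm : race_params) : nat :=
  (#|race_arr prm| * r ^ race_K prm * up_log 2 N.+1)%N.

Definition race_b1 (R : realType) (r : nat) (pv Delta : R) : R :=
  (6 * `|ln pv| + 2 * ln r%:R) / ln Delta^-1.

Definition race_b2 (R : realType) (pv Delta : R) : R :=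
  2 * `|ln pv| / ln Delta^-1.

Definition race_bound (R : realType) (N r v : nat) (delta pv Delta : R) : R :=
  v%:R ^+ 3 * (N%:R `^ race_b1 r pv Delta) *
  ln (v%:R / delta * (N%:R `^ race_b2 pv Delta) * ln (N%:R / delta)) *
  ln (N%:R / delta) * ln N%:R.

(* Points are indexed from 0, so p_v and p_(v+1) belong to the indices v - 1
   and v.  Success must hold for every way of breaking ties. *)
Definition race_solves (R : realType) (N r v : nat) (delta pv Delta : R)
    (prm : race_params) : Prop :=
  forall (X : Type) (sim : X -> X -> R)
    (dT : measure_display) (T : measurableType dT) (mu : probability T R)
    (l : T -> X -> 'I_r)
    (dS : measure_display) (S : measurableType dS) (nu : probability S R)
    (h : S -> 'I_N -> 'I_(race_width prm))
    (dO : measure_display) (Omega : measurableType dO)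
    (P : probability Omega R)
    (z : race_idx prm -> Omega -> T) (u : 'I_(race_rows prm) -> Omega -> S)
    (x : 'I_N -> X) (q : X),
  is_lsh_family mu sim l ->
  is_2universal nu h ->
  iid_seeds P mu nu z u ->
  (forall i j : 'I_N, (i <= j)%N ->
    collision_prob mu l (x j) q <= collision_prob mu l (x i) q) ->
  (forall i : 'I_N, i.+1 = v -> collision_prob mu l (x i) q = pv) ->
  (forall i : 'I_N, i = v :> nat ->
    collision_prob mu l (x i) q / pv = Delta) ->
  nearest sim x q v = [set i : 'I_N | (i < v)%N]%SET /\
  ((1 - delta)%:E <= P [set o |
     let lo := fun e => l (z e o) in
     let ho := fun a => h (u a o) in
     let sketch := race_cms R lo ho (race_stream x) in
     forall Rep : {set 'I_N}, top_set v (race_score lo ho sketch q) Rep ->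
       nearest sim x q v \subset Rep])%E.

(* The parameters are chosen before the data set, the query and the LSH family,
   of which only p_v and Delta are known. *)
Definition race_constructible (R : realType) (C : R) (N r v : nat)
    (delta pv Delta : R) : Prop :=
  exists prm : race_params,
    [/\ race_params_pos prm,
        (race_bits N r prm)%:R <= C * race_bound N r v delta pv Delta,
        (forall (X : Type) (l : race_idx prm -> X -> 'I_r)
           (h : 'I_(race_rows prm) -> 'I_N -> 'I_(race_width prm)),
           one_pass (race_cms R l h)) &
        race_solves N r v delta pv Delta prm].

(* Main.v *)
(* Average each group over m ~ pv^-K arrays, and take K with N * Delta^K below a
   constant, so that m times the total kernel mass of the points outside the v
   nearest is at most 4/9.  A group whose cell contains a near point then sees no
   collision with the query with probability at most (1 - pv^K)^m <= 1/e, while a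
   group whose cell contains only far points sees one with probability at most
   4/9 (Markov).  Hence the median of a cell is positive exactly when the cell
   contains a near point, up to a probability exponentially small in the number of
   groups.  A far point avoids all near points in some row of width 3v, except
   with probability 3^-rows; its score is then nonpositive, whereas the near
   points have positive scores.

   All of this happens in a finite product space, because the scores depend only
   on the hash tables and on which points collide with the query. *)
Require Import Defs.
From HB Require Import structures.
From mathcomp Require Import all_boot all_order all_algebra.
From mathcomp Require Import all_classical all_reals all_analysis.
From mathcomp Require Import zify ring lra.
Set Implicit Arguments.
Unset Strict Implicit.
Unset Printing Implicit Defensive.
Import Order.TTheory GRing.Theory Num.Theory.
Local Open Scope ring_scope.

(** * Products of finite laws *)

Record is_pmf (R : realType) (A : finType) (w : A -> R) : Prop := IsPmf {
  pmf_ge0 : forall a, 0 <= w a;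
  pmf_sum1 : \sum_a w a = 1 }.

Definition prod_pmf (R : realType) (I A : finType) (w : A -> R)
  (f : {ffun I -> A}) : R := \prod_i w (f i).

Definition ecurry (I J A : finType) (f : {ffun I * J -> A}) :
  {ffun I -> {ffun J -> A}} := [ffun i => [ffun j => f (i, j)]].

Section FiniteLaws.
Variables (R : realType) (A : finType) (w : A -> R).

(** Expanding the product of sums runs over all functions from [I] to [A]. This is the form in which
    independence enters most estimates below. *)
Lemma prod_pmf_expect (I : finType) (phi : I -> A -> R) :
  \sum_(f : {ffun I -> A}) prod_pmf w f * (\prod_i phi i (f i)) =
  \prod_i \sum_a w a * phi i a.
Proof.
rewrite bigA_distr_bigA /=; apply: eq_bigr => f _.
by rewrite /prod_pmf -big_split.
Qed.

Hypothesis w_pmf : is_pmf w.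

Lemma prod_pmf_is_pmf (I : finType) : is_pmf (@prod_pmf R I A w).
Proof.
split=> [f|]; first by apply: prodr_ge0 => i _; exact: pmf_ge0.
transitivity (\sum_(f : {ffun I -> A}) prod_pmf w f * \prod_(i : I) 1).
  by apply: eq_bigr => f _; rewrite big1_eq mulr1.
rewrite (prod_pmf_expect (fun _ _ => 1)) big1 // => i _.
by under eq_bigr do rewrite mulr1; exact: pmf_sum1.
Qed.

Lemma prod_pmf_coord (I : finType) (k : I) (phi : A -> R) :
  \sum_(f : {ffun I -> A}) prod_pmf w f * phi (f k) = \sum_a w a * phi a.
Proof.
have := prod_pmf_expect (fun i a => if i == k then phi a else 1).
rewrite (bigD1 k) //= eqxx [X in _ * X]big1 ?mulr1; last first.
  move=> i /negbTE ->; under eq_bigr do rewrite mulr1.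
  exact: pmf_sum1.
move=> <-; apply: eq_bigr => f _; congr (_ * _).
rewrite (bigD1 k) //= eqxx big1 ?mulr1 //.
by move=> i /negbTE ->.
Qed.

(** Currying is a bijection that only regroups the factors of the product, so independent draws
    arranged in blocks form independent blocks. *)
Lemma prod_pmf_curry (I J : finType) (Phi : {ffun I -> {ffun J -> A}} -> R) :
  \sum_(f : {ffun I * J -> A}) prod_pmf w f * Phi (ecurry f) =
  \sum_(F : {ffun I -> {ffun J -> A}})
    prod_pmf (@prod_pmf R J A w) F * Phi F.
Proof.
pose unc (F : {ffun I -> {ffun J -> A}}) : {ffun I * J -> A} :=
  [ffun p => F p.1 p.2].
have ecurryK : cancel (@ecurry I J A) unc.
  by move=> f; apply/ffunP=> -[i j]; rewrite !ffunE.
have uncK : cancel unc (@ecurry I J A).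
  by move=> F; apply/ffunP=> i; apply/ffunP => j; rewrite !ffunE.
rewrite [RHS](reindex (@ecurry I J A)) /=; last first.
  by exists unc => ? _; [exact: ecurryK | exact: uncK].
apply: eq_bigr => f _; congr (_ * _); rewrite /prod_pmf pair_big /=.
by apply: eq_bigr => -[i j] _; rewrite !ffunE.
Qed.

End FiniteLaws.

(** * Medians and majorities *)

Section Median.
Variables (R : realType) (theta : R).

(** The lower middle entry is at most the median, so it and everything sorted before it are at most
    [theta]; these [(size s).-1./2 + 1] entries are at least half of the list. *)
Lemma count_ge_half_le_median (s : seq R) :
  median s <= theta -> (size s <= 2 * count (fun y => y <= theta)%R s)%N.
Proof.
case: (posnP (size s)) => [->//|s_gt0] med.
set s' := sort <=%O s.
have ss' : size s' = size s by rewrite size_sort.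
have s'_sorted : sorted <=%O s' by exact: sort_le_sorted.
set k := (size s).-1./2.
have lek : (k <= (size s)./2)%N by rewrite half_leq // leq_pred.
have ltk : ((size s)./2 < size s)%N by rewrite ltn_half_double -addnn -{1}[size s]addn0 ltn_add2l.
have mono (i j : nat) : (i <= j)%N -> (j < size s)%N -> nth 0 s' i <= nth 0 s' j.
  move=> ij js; apply: (sorted_leq_nth le_trans le_refl) => //; rewrite inE ss' //.
  exact: leq_ltn_trans js.
have nthk : nth 0 s' k <= theta.
  have := mono _ _ lek ltk; move: med; rewrite /median -/s' -/k => h1 h2.
  by apply: le_trans h1; rewrite ler_pdivlMr // mulrDr !mulr1 lerD2l.
have -> : count (fun y => y <= theta)%R s = count (fun y => y <= theta)%R s'.
  by apply/permP; rewrite perm_sym perm_sort.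
have : (k.+1 <= count (fun y => y <= theta)%R s')%N.
  rewrite -[s'](cat_take_drop k.+1) count_cat.
  have szt : size (take k.+1 s') = k.+1.
    by rewrite size_takel // ss' (leq_ltn_trans lek).
  suff -> : count (fun y => y <= theta)%R (take k.+1 s') = k.+1 by exact: leq_addr.
  rewrite -[RHS]szt; apply/eqP; rewrite -all_count; apply/(all_nthP 0) => i.
  rewrite szt => ik; rewrite nth_take //; apply: le_trans nthk.
  exact: mono (leq_ltn_trans lek ltk).
by move: s_gt0; rewrite /k; clear; lia.
Qed.

(** Here the upper middle entry, which is at least the median, is used together with its
    successors. *)
Lemma count_ge_half_gt_median (s : seq R) :
  theta < median s -> (size s <= 2 * count (fun y => theta < y)%R s)%N.
Proof.
case: (posnP (size s)) => [->//|s_gt0] med.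
set s' := sort <=%O s.
have ss' : size s' = size s by rewrite size_sort.
have s'_sorted : sorted <=%O s' by exact: sort_le_sorted.
set k := (size s)./2.
have lek : ((size s).-1./2 <= k)%N by rewrite half_leq // leq_pred.
have ltk : (k < size s)%N by rewrite ltn_half_double -addnn -{1}[size s]addn0 ltn_add2l.
have mono (i j : nat) : (i <= j)%N -> (j < size s)%N -> nth 0 s' i <= nth 0 s' j.
  move=> ij js; apply: (sorted_leq_nth le_trans le_refl) => //; rewrite inE ss' //.
  exact: leq_ltn_trans js.
have nthk : theta < nth 0 s' k.
  have := mono _ _ lek ltk; move: med; rewrite /median -/s' -/k => h1 h2.
  by apply: lt_le_trans h1 _; rewrite ler_pdivrMr // mulrDr !mulr1 lerD2r.
have -> : count (fun y => theta < y)%R s = count (fun y => theta < y)%R s'.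
  by apply/permP; rewrite perm_sym perm_sort.
have : (size s - k <= count (fun y => theta < y)%R s')%N.
  rewrite -[s'](cat_take_drop k) count_cat.
  have szt : size (drop k s') = (size s - k)%N by rewrite size_drop ss'.
  suff -> : count (fun y => theta < y)%R (drop k s') = (size s - k)%N.
    exact: leq_addl.
  rewrite -[RHS]szt; apply/eqP; rewrite -all_count; apply/(all_nthP 0) => i.
  rewrite szt => ik; rewrite nth_drop; apply: lt_le_trans nthk _.
  by apply: mono; [exact: leq_addr|rewrite -ltn_subRL].
by rewrite /k; clear; lia.
Qed.

End Median.

Lemma natr_forall (R : realType) (I : finType) (Q : pred I) :
  [forall i, Q i]%:R = \prod_i (Q i)%:R :> R.
Proof.
case: (boolP [forall i, Q i]) => [/forallP Qi|].
  by rewrite big1 // => i _; rewrite Qi.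
by rewrite negb_forall => /existsP[i /negbTE Qi]; rewrite (bigD1 i) //= Qi mul0r.
Qed.

Lemma natr_exists_le (R : realType) (I : finType) (Q : pred I) :
  [exists i, Q i]%:R <= \sum_i (Q i)%:R :> R.
Proof.
case: (boolP [exists i, Q i]) => [/existsP[i Qi]|_].
  by rewrite (bigD1 i) //= Qi lerDl sumr_ge0.
by apply: sumr_ge0 => i _; exact: ler0n.
Qed.

(* The median fails only if half of the groups fail.  Weighting each failing
   group by 36/25, the square of 6/5, the exponential Markov inequality gives
   the factor (5/6) (1 + 11/25 * 4/9) <= 269/270 per group. *)
Lemma majority_prob (R : realType) (I D : finType) (g : nat) (idx : 'I_g -> I)
    (w : D -> R) (bad : pred D) :
  is_pmf w -> injective idx -> \sum_a w a * (bad a)%:R <= 4 / 9 ->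
  \sum_(f : {ffun I -> D}) prod_pmf w f *
    (g <= 2 * #|[set t | bad (f (idx t))]|)%N%:R <= (269 / 270) ^+ g.
Proof.
move=> w_pmf idx_inj badP.
pose F a : R := 5 / 6 * (36 / 25) ^+ bad a.
(* Coordinates outside the image of [idx] get weight 1 and integrate out. *)
pose phi i a : R := if i \in idx @: 'I_g then F a else 1.
apply: (@le_trans _ _ (\sum_(f : {ffun I -> D})
    prod_pmf w f * \prod_i phi i (f i))).
  apply: ler_sum => f _; apply: ler_wpM2l; first exact: pmf_ge0 (prod_pmf_is_pmf w_pmf I) f.
  rewrite -big_mkcond big_imset /=; last by move=> i j _ _; exact: idx_inj.
  rewrite big_split /= prodr_const card_ord.
  rewrite (_ : \prod_(t in 'I_g) _ = (6 / 5) ^+ (2 * #|[set t | bad (f (idx t))]|)); last first.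
    rewrite prodrXr exprM -sum1_card [in RHS]big_mkcond /=.
    rewrite (_ : (6 / 5) ^+ 2 = 36 / 25 :> R); last by field.
    by congr (_ ^+ _); apply: eq_bigr => t _; rewrite inE; case: (bad _).
  (* If at least half of the groups are bad, the exponent of 6/5 is at least [g], which cancels the
     power of 5/6 and leaves a number at least 1. *)
  case: leqP => [le|_]; last by apply: mulr_ge0; apply: exprn_ge0; lra.
  rewrite -(subnKC le) exprD mulrA -exprMn.
  rewrite (_ : 5 / 6 * (6 / 5) = 1 :> R); last by field.
  by rewrite expr1n mul1r exprn_ege1 //; lra.
rewrite prod_pmf_expect.
rewrite (_ : \prod_i _ = \prod_(i in idx @: 'I_g) \sum_a w a * F a); last first.
  rewrite [RHS]big_mkcond /=; apply: eq_bigr => i _; rewrite /phi.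
  by case: ifP => // _; under eq_bigr do rewrite mulr1; exact: pmf_sum1.
rewrite prodr_const card_imset // card_ord.
have -> : \sum_a w a * F a = 5 / 6 * (1 + 11 / 25 * \sum_a w a * (bad a)%:R).
  transitivity (5 / 6 * (\sum_a w a + 11 / 25 * \sum_a w a * (bad a)%:R)).
    rewrite [11 / 25 * _]mulr_sumr -big_split mulr_sumr /=.
    by apply: eq_bigr => a _; rewrite /F; case: (bad a); rewrite ?expr1 ?expr0 /=; field.
  by rewrite (pmf_sum1 w_pmf).
have s0 : 0 <= \sum_a w a * (bad a)%:R.
  by apply: sumr_ge0 => a _; rewrite mulr_ge0 ?ler0n //; exact: pmf_ge0.
by apply: lerXn2r; rewrite ?nnegrE; lra.
Qed.

(** * Collisions with the query in independent ACE arrays *)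

Section CollisionCounts.
Variables (R : realType) (N : nat) (w : {set 'I_N} -> R).
Hypothesis w_pmf : is_pmf w.
Variables K m : nat.

(** [b j] stands for the set of points that agree with the query on the j-th function of one array,
    so a hit is a point whose whole hash tuple equals that of the query. *)
Definition hit (i : 'I_N) (b : {ffun 'I_K -> {set 'I_N}}) : bool :=
  [forall j, i \in b j].

Let p i := \sum_S w S * (i \in S)%:R.

Lemma hit_prob i : \sum_b prod_pmf w b * (hit i b)%:R = p i ^+ K.
Proof.
under eq_bigr do rewrite natr_forall.
by rewrite (prod_pmf_expect w (fun _ S => (i \in S)%:R)) prodr_const card_ord.
Qed.

Let wK := @prod_pmf R 'I_K {set 'I_N} w.

Lemma miss_prob i :
  \sum_(f : {ffun 'I_m -> _}) prod_pmf wK f * [forall k, ~~ hit i (f k)]%:R =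
  (1 - p i ^+ K) ^+ m.
Proof.
under eq_bigr do rewrite natr_forall.
rewrite (prod_pmf_expect wK (fun _ b => (~~ hit i b)%:R)) prodr_const card_ord.
congr (_ ^+ _); transitivity (\sum_b wK b - p i ^+ K); last first.
  by rewrite (pmf_sum1 (prod_pmf_is_pmf w_pmf 'I_K)).
rewrite -hit_prob -sumrB.
by apply: eq_bigr => b _; case: (hit i b); rewrite ?mulr1 ?mulr0 ?subrr ?subr0.
Qed.

(** The indicator is at most the number of hits, whose expectation is computed by linearity;
    collisions of different points under one draw may be dependent. *)
Lemma any_hit_prob (Q : pred 'I_N) :
  \sum_(f : {ffun 'I_m -> _}) prod_pmf wK f *
    [exists k, [exists i, Q i && hit i (f k)]]%:R <=
  m%:R * \sum_(i | Q i) p i ^+ K.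
Proof.
have wK_pmf : is_pmf wK by exact: prod_pmf_is_pmf.
apply: (@le_trans _ _ (\sum_(f : {ffun 'I_m -> _}) prod_pmf wK f *
    \sum_k \sum_(i | Q i) (hit i (f k))%:R)).
  apply: ler_sum => f _; apply: ler_wpM2l; first exact: pmf_ge0 (prod_pmf_is_pmf wK_pmf _) f.
  apply: le_trans (natr_exists_le _ _) _; apply: ler_sum => k _.
  apply: le_trans (natr_exists_le _ _) _; rewrite [leRHS]big_mkcond /=.
  by apply: ler_sum => i _; case: (Q i).
under eq_bigr do rewrite mulr_sumr.
rewrite exchange_big /=.
under eq_bigr => k _ do rewrite (prod_pmf_coord wK_pmf k (fun b => \sum_(i | Q i) (hit i b)%:R)).
rewrite sumr_const card_ord -[leLHS]mulr_natl ler_wpM2l ?ler0n //.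
rewrite /=; under [X in X <= _]eq_bigr do rewrite mulr_sumr.
by rewrite exchange_big /=; apply: ler_sum => i _; rewrite hit_prob.
Qed.

End CollisionCounts.

(** * The scores as functions of finite data *)

Lemma card_ord_lt (N v : nat) : (v <= N)%N -> #|[set i : 'I_N | (i < v)%N]| = v.
Proof.
move=> vN; have winj : injective (widen_ord vN) by move=> ? ? /(congr1 val) /= /val_inj.
rewrite -[RHS]card_ord -(card_imset _ winj); apply: eq_card => n.
rewrite inE; apply/idP/imsetP => [nv|[k _ ->]]; last exact: (ltn_ord k).
by exists (Ordinal nv) => //; apply: val_inj.
Qed.

Lemma count_enum (T : finType) (Q : pred T) : count Q (enum T) = #|[set t | Q t]|.
Proof.
rewrite -sum1_count big_enum_cond /= -sum1_card.
by apply: eq_bigl => t; rewrite !inE.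
Qed.

(** On a nonempty list the starting value [head 0 s] of the fold is itself an entry, so it adds no
    constraint. *)
Lemma seq_min_gt (R : realType) (s : seq R) (y : R) : s != [::] ->
  (y < seq_min s) = all (fun z => y < z) s.
Proof.
have big_min_gt x t : (y < \big[Num.min/x]_(z <- t) z) =
    (y < x) && all (fun z => y < z) t.
  elim: t => [|z t IH]; first by rewrite big_nil andbT.
  by rewrite big_cons lt_min IH /= andbCA.
by case: s => [//|z s] _; rewrite /seq_min big_min_gt /= andbA andbb.
Qed.

Section CollisionSketch.
Variables (R : realType) (N : nat) (prm : race_params).
Local Notation d := (race_rows prm).
Local Notation width := (race_width prm).
Local Notation groups := (race_groups prm).
Local Notation means := (race_means prm).
Local Notation K := (race_K prm).

(* Which points collide with the query under each LSH draw: the scores depend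
   on the LSH functions through this finite datum only. *)
Definition collisions := {ffun race_idx prm -> {set 'I_N}}.
Definition hash_table := {ffun 'I_d -> {ffun 'I_N -> 'I_width}}.
Implicit Types (f : collisions) (H : hash_table).

(** Curried twice, once for the functions of an array and once for the arrays of a group, so that
    [prod_pmf_curry] exposes the independence of the groups. *)
Definition group_sample f (a : 'I_d) (b : 'I_width) (t : 'I_groups) :
    {ffun 'I_means -> {ffun 'I_K -> {set 'I_N}}} :=
  @ecurry ('I_d * 'I_width * 'I_groups)%type 'I_means _
    (@ecurry (race_arr prm) 'I_K _ f) (a, b, t).

Lemma group_sampleE f a b t k j : group_sample f a b t k j = f ((a, b, t, k), j).
Proof. by rewrite /group_sample !ffunE. Qed.

Definition cell_hits H a b (D : {ffun 'I_means -> {ffun 'I_K -> {set 'I_N}}}) : R :=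
  \sum_k \sum_(i | H a i == b) (hit i (D k))%:R.

Definition cell_est f H a b : R :=
  median [seq cell_hits H a b (group_sample f a b t) / means%:R
         | t <- enum 'I_groups].

Definition score_est f H (i : 'I_N) : R :=
  seq_min [seq cell_est f H a (H a i) | a <- enum 'I_d].

(** The counter read at the query's hash tuple counts the points of the cell that agree with the
    query on all [K] functions, and the collision sets determine this count. *)
Lemma race_scoreE (X : Type) (r : nat) (l : race_idx prm -> X -> 'I_r)
    (h : 'I_d -> 'I_N -> 'I_width) (x : 'I_N -> X) (q : X) (i : 'I_N) :
  race_score l h (race_cms R l h (race_stream x)) q i =
  score_est [ffun e => [set i | l e (x i) == l e q]]
            [ffun a => [ffun i => h a i]] i.
Proof.
rewrite /race_score /score_est; congr seq_min; apply: eq_map => a.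
rewrite /= /race_cell /cell_est !ffunE; congr median; apply: eq_map => t.
rewrite /=; congr (_ / _); apply: eq_bigr => k _; rewrite !ffunE /race_stream big_map big_enum /=.
rewrite [RHS]big_mkcond /=; apply: eq_bigr => j _; rewrite !ffunE /=.
case: (h a j == h a i); rewrite ?mul0r // mul1r; congr (_ %:R); congr nat_of_bool.
apply/eqP/forallP => [/ffunP E n|E].
  by rewrite group_sampleE !ffunE inE; have := E n; rewrite !ffunE => ->.
by apply/ffunP => n; have := E n; rewrite group_sampleE !ffunE inE => /eqP.
Qed.

Definition any_hit H a b (D : {ffun 'I_means -> {ffun 'I_K -> {set 'I_N}}}) :=
  [exists k, [exists i, (H a i == b) && hit i (D k)]].

Variable v : nat.

Definition has_near H a b := [exists i : 'I_N, (i < v)%N && (H a i == b)].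

Definition bad_group H a b D := any_hit H a b D != has_near H a b.

(** Exactly half counts as bad: with an even number of groups the two middle means may then be zero
    and positive, which makes the median positive. *)
Definition bad_cell f H a b :=
  (groups <= 2 * #|[set t | bad_group H a b (group_sample f a b t)]|)%N.

(** A row certifies that [j] is far when no near point shares the cell of [j]; here no row does. *)
Definition missed H (j : 'I_N) := [forall a, has_near H a (H a j)].

Lemma cell_hits_gt0 H a b D : (0 < cell_hits H a b D) = any_hit H a b D.
Proof.
rewrite /any_hit; case: existsP => [[k /existsP[i /andP[Hi hi]]]|no].
  apply: (@lt_le_trans _ _ 1) => //; rewrite /cell_hits (bigD1 k) //= (bigD1 i) //= hi.
  by rewrite -addrA lerDl addr_ge0 ?sumr_ge0 // => n _; rewrite sumr_ge0.
rewrite /cell_hits big1 ?ltxx // => k _; rewrite big1 // => i Hi.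
by case: (boolP (hit i (D k))) => // hi; case: no; exists k; apply/existsP; exists i; rewrite Hi.
Qed.

Hypothesis prm_pos : race_params_pos prm.

(** The mean of a group is positive exactly when the group has a hit, so a median on the wrong side
    of zero forces at least half of the groups to be bad. *)
Lemma cell_est_gt0 f H a b : ~~ bad_cell f H a b ->
  (0 < cell_est f H a b) = has_near H a b.
Proof.
case/and5P: prm_pos => _ _ _ _ m_gt0; move=> good.
have posE D : (0 < cell_hits H a b D / means%:R) = any_hit H a b D.
  by rewrite -cell_hits_gt0 pmulr_lgt0 // invr_gt0 ltr0n.
apply/idP/idP => [gt0|near]; last rewrite ltNge.
  apply: contraNT good => near; rewrite /bad_cell.
  have := count_ge_half_gt_median gt0.
  rewrite size_map -cardE card_ord => /leq_trans; apply; rewrite leq_mul2l /=.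
  rewrite count_map count_enum; apply: subset_leq_card; apply/fintype.subsetP => t.
  by rewrite !inE /= posE /bad_group (negbTE near) => ->.
apply: contra good => le0; rewrite /bad_cell.
have := count_ge_half_le_median le0.
rewrite size_map -cardE card_ord => /leq_trans; apply; rewrite leq_mul2l /=.
rewrite count_map count_enum; apply: subset_leq_card; apply/fintype.subsetP => t.
by rewrite !inE /= leNgt posE /bad_group near => /negbTE ->.
Qed.

(** All rows of a near point are positive, whereas a far point that is not missed has a nonpositive
    row and hence a nonpositive minimum. The two kinds therefore never tie. *)
Lemma top_set_near f H (S : {set 'I_N}) :
  (forall j : 'I_N, (v <= j)%N -> ~~ missed H j) ->
  (forall a b, ~~ bad_cell f H a b) -> (v <= N)%N ->
  top_set v (score_est f H) S -> [set i : 'I_N | (i < v)%N] \subset S.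
Proof.
case/and5P: prm_pos => _ d_gt0 _ _ _ found good vN [cardS topS].
have enum_n0 (T : finType) (F : T -> R) : (0 < #|T|)%N -> [seq F a | a <- enum T] != [::].
  by rewrite -size_eq0 size_map -cardE lt0n.
have score_gt0 i : (0 < score_est f H i) = [forall a, has_near H a (H a i)].
  rewrite /score_est seq_min_gt ?enum_n0 ?card_ord // all_map.
  apply/allP/forallP => [h a|h a _] /=.
    by rewrite -(cell_est_gt0 (good _ _)); apply: h; rewrite mem_enum.
  by rewrite cell_est_gt0.
apply/fintype.subsetP => i; rewrite inE => iv; apply: contraT => iS.
(* If [S] held near points only, its [v] elements would be all of them, including [i]. *)
have [j jS vj] : exists2 j, j \in S & (v <= j)%N.
  apply/exists_inP; apply: contraNT iS; rewrite negb_exists_in => /forall_inP Sv.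
  suff /eqP -> : S == [set i : 'I_N | (i < v)%N] by rewrite inE.
  rewrite eqEcard card_ord_lt // cardS leqnn andbT; apply/fintype.subsetP => n /Sv.
  by rewrite -ltnNge inE.
have := topS _ _ jS iS; rewrite leNgt => /negP[].
have := found j vj; rewrite /missed -score_gt0 -leNgt => /le_lt_trans; apply.
by rewrite score_gt0; apply/forallP => a; apply/existsP; exists i; rewrite iv eqxx.
Qed.

End CollisionSketch.

(** * Failure probability *)

(** The square of [1 + 1/2 <= expR (1/2)]; it serves to put [1/e] below 4/9. *)
Lemma expR1_ge (R : realType) : 9 / 4 <= expR 1 :> R.
Proof.
have -> : expR 1 = expR 2^-1 * expR 2^-1 :> R.
  by rewrite -expRD; congr expR; field.
rewrite (_ : 9 / 4 = 3 / 2 * (3 / 2) :> R); last by field.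
have : 3 / 2 <= expR (2^-1) :> R by have := expR_ge1Dx (2^-1 : R); lra.
by move=> h; apply: ler_pM => //; lra.
Qed.

(** From [1 - y <= expR (- y)]. With [y] the probability that one array hits a given point, this
    bounds the chance that all [m] arrays miss it. *)
Lemma exprB_le49 (R : realType) (m : nat) (y : R) :
  y <= 1 -> 1 <= m%:R * y -> (1 - y) ^+ m <= 4 / 9.
Proof.
move=> y1 my; apply: (@le_trans _ _ (expR (- y) ^+ m)).
  by apply: lerXn2r; rewrite ?nnegrE ?expR_ge0 ?subr_ge0 //; exact: expR_ge1Dx.
rewrite -expRM_natl mulrN expRN -[4 / 9]invrK lef_pV2 ?posrE ?expR_gt0 ?invr_gt0 //.
apply: le_trans (_ : expR 1 <= _); last by rewrite ler_expR.
by apply: le_trans (expR1_ge R); rewrite invf_div.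
Qed.

Section FailureProbability.
Variables (R : realType) (N v : nat) (prm : race_params).
Local Notation d := (race_rows prm).
Local Notation width := (race_width prm).
Local Notation groups := (race_groups prm).
Local Notation means := (race_means prm).
Local Notation K := (race_K prm).
Variables (w : {set 'I_N} -> R) (wh : {ffun 'I_N -> 'I_width} -> R).
Variables (pv Delta : R).
Let p i := \sum_S w S * (i \in S)%:R.

Hypothesis w_pmf : is_pmf w.
Hypothesis wh_pmf : is_pmf wh.
Hypothesis v_gt0 : (0 < v)%N.
Hypothesis near_p : forall i : 'I_N, (i < v)%N -> pv <= p i.
Hypothesis far_p : forall i : 'I_N, (v <= i)%N -> p i <= Delta * pv.
Hypothesis hash_coll : forall i j : 'I_N, i != j ->
  \sum_phi wh phi * (phi i == phi j)%:R <= width%:R^-1.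
Hypothesis pv_gt0 : 0 < pv.
Hypothesis Delta_ge0 : 0 <= Delta.
Hypothesis widthE : width = (3 * v)%N.
Hypothesis means_ge : 1 <= means%:R * pv ^+ K.
Hypothesis means_le : means%:R * pv ^+ K <= 2.
Hypothesis DeltaK : N.-1%:R * Delta ^+ K <= 2 / 9.

Let wK := @prod_pmf R 'I_K {set 'I_N} w.
Let wD := @prod_pmf R 'I_means {ffun 'I_K -> {set 'I_N}} wK.

Let wK_pmf : is_pmf wK. Proof. exact: prod_pmf_is_pmf. Qed.
Let wD_pmf : is_pmf wD. Proof. exact: prod_pmf_is_pmf. Qed.

Lemma bad_group_prob (H : hash_table N prm) a b :
  \sum_D wD D * (bad_group v H a b D)%:R <= 4 / 9.
Proof.
have p_ge0 i : 0 <= p i.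
  by apply: sumr_ge0 => S _; rewrite mulr_ge0 ?ler0n ?pmf_ge0.
rewrite /bad_group; case: (boolP (has_near v H a b)) => [/existsP[i /andP[iv Hi]]|none].
  apply: (@le_trans _ _ ((1 - p i ^+ K) ^+ means)).
    rewrite -(miss_prob w_pmf); apply: ler_sum => D _.
    apply: ler_wpM2l; first exact: pmf_ge0.
    rewrite ler_nat; case: forallP => [_|]; first exact: leq_b1.
    move=> h; rewrite leqn0 eqb0 negbK eqb_id; apply/existsP.
    have /existsP[k] : [exists k, hit i (D k)].
      by rewrite -[X in is_true X]negbK negb_exists; apply/negP => /forallP.
    by move=> hk; exists k; apply/existsP; exists i; rewrite Hi.
  have piv : pv ^+ K <= p i ^+ K.
    by apply: lerXn2r; rewrite ?nnegrE ?(ltW pv_gt0) ?near_p.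
  apply: exprB_le49; last by apply: le_trans means_ge _; rewrite ler_wpM2l ?ler0n.
  apply: exprn_ile1 => //; rewrite -[leRHS](pmf_sum1 w_pmf); apply: ler_sum => S _.
  by rewrite ler_piMr ?pmf_ge0 // lern1 leq_b1.
apply: (@le_trans _ _ (means%:R * \sum_(i : 'I_N | (v <= i)%N) p i ^+ K)).
  apply: le_trans (any_hit_prob w_pmf K means (fun i => v <= i)%N).
  apply: ler_sum => D _; apply: ler_wpM2l; first exact: pmf_ge0.
  rewrite eqbF_neg negbK ler_nat; case: (boolP (any_hit H a b D)) => //.
  move=> /existsP[k /existsP[i /andP[Hi hi]]].
  rewrite lt0b; apply/existsP; exists k; apply/existsP; exists i; rewrite hi andbT leqNgt.
  by apply: contra none => iv; apply/existsP; exists i; rewrite iv.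
(* Point 0 is near because [v] is positive, so at most [N.-1] points are far. This sharper count is
   what lets the choice of [K] work down to [N = 3]. *)
apply: (@le_trans _ _ (means%:R * ((N.-1)%:R * (Delta * pv) ^+ K))).
  rewrite ler_wpM2l ?ler0n //.
  apply: (@le_trans _ _ (\sum_(i : 'I_N | (v <= i)%N) (Delta * pv) ^+ K)).
    by apply: ler_sum => i vi; apply: lerXn2r; rewrite ?nnegrE ?mulr_ge0 ?(ltW pv_gt0) // far_p.
  rewrite sumr_const -[leLHS]mulr_natl ler_wpM2r ?exprn_ge0 ?mulr_ge0 ?(ltW pv_gt0) //.
  rewrite ler_nat; case: (posnP N) => [N0|N_gt0].
    by rewrite (leq_trans (max_card _)) // card_ord N0.
  rewrite -ltnS prednK // -[X in (_ < X)%N]card_ord; apply: proper_card.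
  apply/properP; split; first exact/fintype.subsetP.
  by exists (Ordinal N_gt0) => //; rewrite unfold_in /= -ltnNge.
rewrite exprMn.
have h0 : 0 <= pv ^+ K by rewrite exprn_ge0 // ltW.
rewrite [X in X <= _](_ : _ = (means%:R * pv ^+ K) * (N.-1%:R * Delta ^+ K)); last by ring.
apply: le_trans (_ : 2 * (2 / 9) <= _); last lra.
by apply: ler_pM; rewrite ?mulr_ge0 ?exprn_ge0 ?ler0n ?(ltW pv_gt0).
Qed.

(** The hash table is held fixed. After both curryings the groups of the cell [(a, b)] are distinct
    coordinates of a product law, so [majority_prob] applies. *)
Lemma bad_cell_prob (H : hash_table N prm) a b :
  \sum_(f : collisions N prm) prod_pmf w f * (bad_cell v f H a b)%:R <=
  (269 / 270) ^+ groups.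
Proof.
pose idx (t : 'I_groups) := (a, b, t).
have idx_inj : injective idx by move=> ? ? [].
pose Phi2 (F : {ffun 'I_d * 'I_width * 'I_groups ->
    {ffun 'I_means -> {ffun 'I_K -> {set 'I_N}}}}) : R :=
  (groups <= 2 * #|[set t | bad_group v H a b (F (idx t))]|)%N%:R.
pose Phi1 (F : {ffun race_arr prm -> {ffun 'I_K -> {set 'I_N}}}) :=
  Phi2 (@ecurry ('I_d * 'I_width * 'I_groups)%type 'I_means _ F).
rewrite (@prod_pmf_curry _ _ w (race_arr prm) 'I_K Phi1).
rewrite (@prod_pmf_curry _ _ wK ('I_d * 'I_width * 'I_groups)%type 'I_means Phi2).
exact: majority_prob wD_pmf idx_inj (bad_group_prob H a b).
Qed.

(** In one row, 2-universality bounds the expected number of near points in the cell of [j] by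
    [v / (3v)], and the [d] rows are independent. *)
Lemma missed_prob (j : 'I_N) : (v <= j)%N ->
  \sum_(H : hash_table N prm) prod_pmf wh H * (missed v H j)%:R <= 3^-1 ^+ d.
Proof.
move=> vj; rewrite /missed; under eq_bigr do rewrite natr_forall.
pose near (phi : {ffun 'I_N -> 'I_width}) := [exists i : 'I_N, (i < v)%N && (phi i == phi j)].
rewrite (prod_pmf_expect wh (fun (_ : 'I_d) phi => (near phi)%:R)) prodr_const card_ord.
apply: lerXn2r; rewrite ?nnegrE ?invr_ge0 //.
  by apply: sumr_ge0 => phi _; rewrite mulr_ge0 ?ler0n ?pmf_ge0.
apply: (@le_trans _ _ (\sum_phi wh phi * \sum_(i : 'I_N | (i < v)%N) (phi i == phi j)%:R)).
  apply: ler_sum => phi _; apply: ler_wpM2l; first exact: pmf_ge0.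
  apply: le_trans (natr_exists_le _ _) _; rewrite [leRHS]big_mkcond /=.
  by apply: ler_sum => i _; case: (_ < v)%N.
under eq_bigr do rewrite mulr_sumr.
rewrite exchange_big /=.
apply: (@le_trans _ _ (\sum_(i : 'I_N | (i < v)%N) width%:R^-1)).
  apply: ler_sum => i iv; apply: hash_coll.
  by apply: contraTneq iv => ->; rewrite -leqNgt.
rewrite sumr_const -[leLHS]mulr_natl widthE natrM invfM mulrCA ler_piMr ?invr_ge0 //.
rewrite ler_pdivrMr ?ltr0n // mul1r ler_nat.
have vN : (v <= N)%N by exact: leq_trans vj (ltnW (ltn_ord j)).
rewrite -[leqRHS](card_ord_lt vN); apply: subset_leq_card.
by apply/fintype.subsetP => n; rewrite unfold_in inE.
Qed.

Definition sketch_good (f : collisions N prm) (H : hash_table N prm) :=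
  [forall j : 'I_N, (v <= j)%N ==> ~~ missed v H j] &&
  [forall a, [forall b, ~~ bad_cell v f H a b]].

Lemma sketch_failure_prob :
  \sum_f \sum_H prod_pmf w f * prod_pmf wh H * (~~ sketch_good f H)%:R <=
  N%:R * 3^-1 ^+ d + (d * width)%:R * (269 / 270) ^+ groups.
Proof.
have wf_pmf := prod_pmf_is_pmf w_pmf (race_idx prm).
have wH_pmf : is_pmf (prod_pmf wh : hash_table N prm -> R) by exact: prod_pmf_is_pmf.
apply: (@le_trans _ _ (\sum_f \sum_H prod_pmf w f * prod_pmf wh H *
   (\sum_(j : 'I_N | (v <= j)%N) (missed v H j)%:R +
    \sum_a \sum_b (bad_cell v f H a b)%:R))).
  apply: ler_sum => f _; apply: ler_sum => H _.
  apply: ler_wpM2l; first by rewrite mulr_ge0 ?(pmf_ge0 wf_pmf) ?(pmf_ge0 wH_pmf).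
  rewrite negb_and; apply: (@le_trans _ _
    ((~~ [forall j : 'I_N, (v <= j)%N ==> ~~ missed v H j])%:R +
     (~~ [forall a, [forall b, ~~ bad_cell v f H a b]])%:R)).
    by do 2!case: (~~ _); rewrite /= ?addr0 ?add0r // lerDl.
  apply: lerD.
    rewrite negb_forall; apply: le_trans (natr_exists_le _ _) _.
    rewrite [leRHS]big_mkcond /=; apply: ler_sum => j _.
    by rewrite negb_imply negbK; case: (v <= j)%N.
  rewrite negb_forall; apply: le_trans (natr_exists_le _ _) _.
  apply: ler_sum => a _; rewrite negb_forall.
  apply: le_trans (natr_exists_le _ _) _; apply: ler_sum => b _.
  by rewrite negbK.
under eq_bigr => f _ do under eq_bigr => H _ do rewrite mulrDr.
under eq_bigr => f _ do rewrite big_split /=.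
rewrite big_split /=; apply: lerD.
  (* Being missed depends on the hash table only, so the sum over [f] contributes 1. *)
  rewrite exchange_big /=.
  apply: (@le_trans _ _ (\sum_(j : 'I_N | (v <= j)%N) 3^-1 ^+ d)); last first.
    rewrite sumr_const -[leLHS]mulr_natl ler_wpM2r ?exprn_ge0 ?invr_ge0 //.
    by rewrite ler_nat (leq_trans (max_card _)) // card_ord.
  apply: le_trans (ler_sum _ missed_prob); rewrite [leRHS]exchange_big /=.
  apply: ler_sum => H _; rewrite -mulr_sumr.
  under eq_bigr do rewrite -mulrA.
  by rewrite -mulr_suml (pmf_sum1 wf_pmf) mul1r.
(* The table is fixed first: the bound on a bad cell holds for every table, hence also on
   average. *)
rewrite exchange_big /=.
apply: (@le_trans _ _ (\sum_(H : hash_table N prm) 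
    prod_pmf wh H * ((d * width)%:R * (269 / 270) ^+ groups))); last first.
  by rewrite -mulr_suml (pmf_sum1 wH_pmf) mul1r.
apply: ler_sum => H _.
under eq_bigr => f _ do rewrite [_ f * _]mulrC -mulrA.
rewrite -mulr_sumr; apply: ler_wpM2l; first exact: (pmf_ge0 wH_pmf).
under eq_bigr => f _ do rewrite mulr_sumr; rewrite exchange_big /=.
rewrite natrM -mulrA mulr_natl -[X in _ *+ X]card_ord -sumr_const; apply: ler_sum => a _.
under eq_bigr => f _ do rewrite mulr_sumr; rewrite exchange_big /=.
rewrite mulr_natl -[X in _ *+ X]card_ord -sumr_const; apply: ler_sum => b _.
exact: bad_cell_prob.
Qed.

End FailureProbability.

(** * Finitely valued observations *)

Section FiniteValued.
Variables (R : realType) (dT : measure_display) (T : measurableType dT).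

Lemma measurable_forall (I : finType) (F : I -> T -> Prop) :
  (forall i, measurable [set t | F i t]%classic) ->
  measurable [set t | forall i, F i t]%classic.
Proof.
move=> mF; rewrite (_ : mkset _ = \bigcap_(i in setT) [set t | F i t])%classic.
  by apply: fin_bigcap_measurable => //; exact: finite_finset.
by apply/seteqP; split => t /=; [move=> h i _; exact: h|move=> h i; exact: h].
Qed.

Lemma measurable_exists (I : finType) (F : I -> T -> Prop) :
  (forall i, measurable [set t | F i t]%classic) ->
  measurable [set t | exists i, F i t]%classic.
Proof.
move=> mF; rewrite (_ : mkset _ = \bigcup_(i in setT) [set t | F i t])%classic.
  by apply: fin_bigcup_measurable => //; exact: finite_finset.
by apply/seteqP; split => t /= -[i]; [exists i|move=> _; exists i].
Qed.

Variables (A : finType) (c : T -> A).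
Hypothesis c_meas : forall a, measurable [set t | c t = a]%classic.

(** A finite union of level sets. [Q] takes values in [Prop] so that it covers the success event,
    which quantifies over all reports. *)
Lemma finite_valued_measurable (Q : A -> Prop) :
  measurable [set t | Q (c t)]%classic.
Proof.
rewrite (_ : mkset _ = [set t | exists a, Q a /\ c t = a])%classic.
  apply: measurable_exists => a; case: (pselect (Q a)) => Qa.
    by rewrite (_ : mkset _ = [set t | c t = a])%classic //; apply/seteqP; split => t //= -[].
  by rewrite (_ : mkset _ = set0)%classic //; apply/seteqP; split => t //= -[].
by apply/seteqP; split => t /=; [move=> Qc; exists (c t)|move=> [a [Qa ->]]].
Qed.

Variable mu : probability T R.

Definition law (a : A) : R := fine (mu [set t | c t = a]%classic).

Lemma finite_valued_prob (Q : pred A) :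
  mu [set t | Q (c t)]%classic = (\sum_a law a * (Q a)%:R)%:E.
Proof.
have prob_in (s : seq A) : uniq s ->
    mu [set t | c t \in s]%classic = (\sum_(a <- s) law a)%:E.
  elim: s => [_|a s IH /andP[aNs us]].
    rewrite big_nil (_ : mkset _ = set0)%classic ?measure0 //.
    by apply/seteqP; split.
  rewrite big_cons EFinD -IH // /law fineK ?fin_num_measure //.
  rewrite (_ : mkset _ = [set t | c t = a] `|` [set t | c t \in s])%classic.
    rewrite measureU //; first exact: (finite_valued_measurable (fun a => a \in s)).
    by apply/seteqP; split => t //= -[-> sa]; rewrite sa in aNs.
  apply/seteqP; split => t /=; rewrite in_cons.
    by case/orP => [/eqP|]; [left|right].
  by case=> [->|->]; rewrite ?eqxx ?orbT.
rewrite (_ : mkset _ = [set t | c t \in enum Q])%classic; last first.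
  by apply/seteqP; split => t /=; rewrite mem_enum.
rewrite prob_in ?enum_uniq // big_enum big_mkcond /=; congr EFin.
by apply: eq_bigr => a _; rewrite unfold_in; case: (Q a); rewrite ?mulr1 ?mulr0.
Qed.

Lemma law_is_pmf : is_pmf law.
Proof.
split=> [a|]; first by rewrite fine_ge0.
have := finite_valued_prob predT; rewrite (_ : mkset _ = setT)%classic.
  by rewrite probability_setT => -[->]; apply: eq_bigr => a _; rewrite mulr1.
by apply/seteqP; split.
Qed.

End FiniteValued.

(** * Joint law of finite observations of independent seeds *)

Section Seeds.
Variables (R : realType) (dT dS dO : measure_display).
Variables (T : measurableType dT) (S : measurableType dS) (Omega : measurableType dO).
Variables (mu : probability T R) (nu : probability S R) (P : probability Omega R).
Variables (I J A B : finType) (z : I -> Omega -> T) (u : J -> Omega -> S).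
Variables (c : T -> A) (k : S -> B).
Hypothesis c_meas : forall a, measurable [set t | c t = a]%classic.
Hypothesis k_meas : forall b, measurable [set s | k s = b]%classic.
Hypothesis seeds : iid_seeds P mu nu z u.

Let obs (o : Omega) : {ffun I -> A} * {ffun J -> B} :=
  ([ffun i => c (z i o)], [ffun j => k (u j o)]).

Let obsE f g : ([set o | obs o = (f, g)] =
  [set o | (forall i, [set t | c t = f i] (z i o)) /\
           (forall j, [set s | k s = g j] (u j o))])%classic.
Proof.
apply/seteqP; split => o /=.
  by move=> [/ffunP ef /ffunP eg]; split=> i; [rewrite -ef|rewrite -eg]; rewrite ffunE.
by move=> [ef eg]; congr pair; apply/ffunP => i; rewrite ffunE.
Qed.

Lemma seeds_obs_meas fg : measurable [set o | obs o = fg]%classic.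
Proof.
case: fg => f g; rewrite obsE.
rewrite (_ : mkset _ = [set o | forall i, c (z i o) = f i] `&`
                      [set o | forall j, k (u j o) = g j])%classic //.
apply: measurableI; apply: measurable_forall => i; rewrite -[mkset _]setTI.
  exact: (iid_measurable_l seeds i measurableT (c_meas (f i))).
exact: (iid_measurable_r seeds i measurableT (k_meas (g i))).
Qed.

(** A level set of [obs] is a rectangle of events on the individual seeds, which is the shape that
    [iid_law] evaluates. *)
Lemma seeds_obs_law f g :
  law obs P (f, g) = prod_pmf (law c mu) f * prod_pmf (law k nu) g.
Proof.
rewrite /law obsE.
by rewrite (iid_law seeds (fun i => c_meas (f i)) (fun j => k_meas (g j))).
Qed.

End Seeds.

(** * From finite laws to the sketch *)

(** The points more similar than a near point lie among the first [v] and exclude that point itself,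
    so there are fewer than [v]; a far point is beaten by all [v] near ones. *)
Lemma nearest_lt (R : realType) (X : Type) (N v : nat) (sim : X -> X -> R)
    (x : 'I_N -> X) (q : X) : (v <= N)%N ->
  (forall i j : 'I_N, (i < v)%N -> (v <= j)%N -> sim (x j) q < sim (x i) q) ->
  nearest sim x q v = [set i : 'I_N | (i < v)%N].
Proof.
move=> vN sep.
apply/setP => i; rewrite !inE -[X in (_ < X)%N = _](card_ord_lt vN); case: (ltnP i v) => iv.
  apply: proper_card; apply/properP; split.
    apply/fintype.subsetP => j; rewrite !inE; apply: contraTT; rewrite -leqNgt => vj.
    by rewrite -leNgt; apply/ltW/sep.
  by exists i; rewrite !inE ?iv ?ltxx.
apply/negbTE; rewrite -leqNgt; apply: subset_leq_card; apply/fintype.subsetP => j.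
by rewrite !inE => jv; exact: sep.
Qed.

Section Solves.
Variables (R : realType) (N r v : nat) (delta pv Delta : R) (prm : race_params).

Lemma race_solves_of_failure_bound :
  race_params_pos prm -> (0 < v < N)%N -> 0 < pv -> 0 < Delta < 1 ->
  race_width prm = (3 * v)%N ->
  1 <= (race_means prm)%:R * pv ^+ race_K prm ->
  (race_means prm)%:R * pv ^+ race_K prm <= 2 ->
  N.-1%:R * Delta ^+ race_K prm <= 2 / 9 ->
  N%:R * 3^-1 ^+ race_rows prm +
    (race_rows prm * race_width prm)%:R * (269 / 270) ^+ race_groups prm <= delta ->
  race_solves N r v delta pv Delta prm.
Proof.
move=> prm_pos /andP[v_gt0 vN] pv_gt0 /andP[D_gt0 D_lt1] widthE m_ge m_le DK fail_le.
move=> X sim dT T mu l dS S nu h dO Omega P z u x q lsh univ seeds mono at_v at_v1.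
have [l_meas [phi [phi_mono phiE]]] := lsh.
have [h_meas h_coll] := univ.
have lt_v1 : (v.-1 < N)%N by rewrite prednK // ltnW.
have near_p (i : 'I_N) : (i < v)%N -> pv <= collision_prob mu l (x i) q.
  move=> iv; rewrite -(at_v (Ordinal lt_v1)) /= ?prednK //; apply: mono => /=.
  by rewrite -ltnS prednK.
have far_p (i : 'I_N) : (v <= i)%N -> collision_prob mu l (x i) q <= Delta * pv.
  move=> vi; rewrite -(at_v1 (Ordinal vN)) // divfK ?gt_eqF //.
  exact: mono.
have -> : nearest sim x q v = [set i : 'I_N | (i < v)%N].
  apply: nearest_lt => [|i j iv vj]; first exact: ltnW.
  (* A monotone [phi] reflects strict inequalities, so the gap in collision probability carries over
     to the similarities. *)
  have : collision_prob mu l (x j) q < collision_prob mu l (x i) q.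
    apply: le_lt_trans (far_p _ vj) _; apply: lt_le_trans (near_p _ iv).
    by rewrite gtr_pMl.
  by rewrite !phiE; apply: contraTT; rewrite -!leNgt => /phi_mono.
split=> //.
have eq_meas (a b : X) : measurable [set t | l t a = l t b]%classic.
  rewrite (_ : mkset _ = [set t | exists j : 'I_r, l t a = j /\ l t b = j])%classic.
    by apply: measurable_exists => j; apply: measurableI; exact: l_meas.
  by apply/seteqP; split => t /=; [exists (l t b)|case=> j [-> ->]].
(* From here on each seed is replaced by a finite datum: the set of points colliding with the query,
   or a hash function tabulated on all indices. *)
pose c t : {set 'I_N} := [set i | l t (x i) == l t q].
pose k s : {ffun 'I_N -> 'I_(race_width prm)} := [ffun i => h s i].
have c_meas C : measurable [set t | c t = C]%classic.
  rewrite (_ : mkset _ = [set t | forall i : 'I_N, (l t (x i) == l t q) = (i \in C)])%classic.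
    apply: measurable_forall => i; case: (i \in C).
      rewrite (_ : mkset _ = [set t | l t (x i) = l t q])%classic //.
      by apply/seteqP; split => t /= /eqP.
    rewrite (_ : mkset _ = ~` [set t | l t (x i) = l t q])%classic.
      by apply: measurableC.
    by apply/seteqP; split => t /= => [/negbT /eqP|/eqP /negbTE].
  apply/seteqP; split => t /=; first by move=> <- i; rewrite inE.
  by move=> e; apply/setP => i; rewrite inE.
have k_meas phi' : measurable [set s | k s = phi']%classic.
  rewrite (_ : mkset _ = [set s | forall i : 'I_N, h s i = phi' i])%classic.
    by apply: measurable_forall => i; exact: h_meas.
  apply/seteqP; split => s /=; first by move=> <- i; rewrite ffunE.
  by move=> e; apply/ffunP => i; rewrite ffunE.
have pE (i : 'I_N) : collision_prob mu l (x i) q = \sum_C law c mu C * (i \in C)%:R.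
  rewrite /collision_prob (_ : mkset _ = [set t | i \in c t])%classic.
    by rewrite (finite_valued_prob c_meas mu (fun C => i \in C)).
  by apply/seteqP; split => t /=; rewrite inE => /eqP.
have hE (i j : 'I_N) : i != j ->
    \sum_phi' law k nu phi' * (phi' i == phi' j)%:R <= (race_width prm)%:R^-1.
  move=> ij; have := h_coll _ _ ij; rewrite /collision_prob.
  rewrite (_ : mkset _ = [set s | k s i == k s j])%classic.
    by rewrite (finite_valued_prob k_meas nu (fun phi' => phi' i == phi' j)).
  by apply/seteqP; split => s /=; rewrite !ffunE => /eqP.
pose obs o : collisions N prm * hash_table N prm :=
  ([ffun e => c (z e o)], [ffun a => k (u a o)]).
have obs_meas fH : measurable [set o | obs o = fH]%classic.
  exact: seeds_obs_meas c_meas k_meas seeds fH.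
have obs_law f H : law obs P (f, H) = prod_pmf (law c mu) f * prod_pmf (law k nu) H.
  exact: seeds_obs_law c_meas k_meas seeds f H.
have scoreE o : race_score (fun e => l (z e o)) (fun a => h (u a o))
    (race_cms R (fun e => l (z e o)) (fun a => h (u a o)) (race_stream x)) q =
    @score_est R N prm (obs o).1 (obs o).2.
  by apply: funext => i; rewrite race_scoreE.
pose solved fH := forall Rep : {set 'I_N},
  top_set v (@score_est R N prm fH.1 fH.2) Rep -> [set i : 'I_N | (i < v)%N] \subset Rep.
rewrite (_ : mkset _ = [set o | solved (obs o)])%classic; last first.
  by apply/seteqP; split => o /=; rewrite scoreE.
have good_sub : ([set o | sketch_good v (obs o).1 (obs o).2] `<=` [set o | solved (obs o)])%classic.
  move=> o /= /andP[/forallP found /forallP good] Rep.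
  apply: top_set_near => // [j vj|a b|]; last exact: ltnW.
    by have := found j; rewrite vj.
  by have /forallP := good a.
apply: (@le_trans _ _ (P [set o | sketch_good v (obs o).1 (obs o).2]%classic)); last first.
  apply: (le_measure P _ _ good_sub); rewrite inE.
    exact: (finite_valued_measurable obs_meas (fun fH => sketch_good v fH.1 fH.2)).
  exact: (finite_valued_measurable obs_meas solved).
have -> : P [set o | sketch_good v (obs o).1 (obs o).2]%classic = _ :=
  finite_valued_prob obs_meas P (fun fH => sketch_good v fH.1 fH.2).
rewrite lee_fin.
have w_pmf := law_is_pmf c_meas mu; have wh_pmf := law_is_pmf k_meas nu.
have := pmf_sum1 (law_is_pmf obs_meas P).
have fail : \sum_fH law obs P fH * (~~ sketch_good v fH.1 fH.2)%:R <= delta.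
  apply: le_trans fail_le.
  rewrite (_ : \sum_fH _ = \sum_f \sum_H prod_pmf (law c mu) f *
      prod_pmf (law k nu) H * (~~ sketch_good v f H)%:R); last first.
    by rewrite pair_bigA /=; apply: eq_bigr => -[f H] _; rewrite obs_law.
  apply: (sketch_failure_prob (pv := pv) (Delta := Delta)) => //.
  - by move=> i iv; rewrite -pE; exact: near_p.
  - by move=> i iv; rewrite -pE; exact: far_p.
  - exact: ltW.
move=> sum1; rewrite lerBlDr -[leLHS]sum1; apply: le_trans (lerD (lexx _) fail).
rewrite -big_split /=; apply: ler_sum => fH _; rewrite -mulrDr.
by case: (sketch_good _ _ _); rewrite /= ?addr0 ?add0r mulr1.
Qed.

End Solves.

(** * Choice of the parameters *)

(** Each counter is a sum over the stream, so a new element adds its own contribution. *)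
Lemma race_cms_one_pass (R : realType) (N r : nat) (prm : race_params) (X : Type)
    (l : race_idx prm -> X -> 'I_r)
    (h : 'I_(race_rows prm) -> 'I_N -> 'I_(race_width prm)) :
  one_pass (race_cms R l h).
Proof.
pose update (A : race_counters R r prm) (e : 'I_N * X) : race_counters R r prm :=
  [ffun c => [ffun j => A c j + (h c.1.1.1 e.1 == c.1.1.2)%:R *
    (lsh_tuple (fun k => l (c, k)) e.2 == j)%:R]].
exists update.
move=> s e; apply/ffunP => -[[[a b] t] k]; apply/ffunP => j.
by rewrite !ffunE -cats1 big_cat big_seq1.
Qed.

(** * Size bounds and the parameters that meet them *)

Section Size.
Variable R : realType.
Implicit Types (x y pv delta Delta : R) (N K v r : nat).

(** The sixth root is taken because 6 is the first [n] for which the bound [(1 - 1/n)^n] exceeds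
    1/3. *)
Lemma expRN1_ge : 3^-1 < expR (-1) :> R.
Proof.
have -> : expR (-1) = expR (- 6^-1) ^+ 6 :> R.
  by rewrite -expRM_natl; congr expR; field.
have : 5 / 6 <= expR (- 6^-1) :> R by have := expR_ge1Dx (- 6^-1 : R); lra.
move=> h; apply: lt_le_trans (_ : (5 / 6) ^+ 6 <= _); first lra.
by apply: lerXn2r; rewrite ?nnegrE ?expR_ge0 //; lra.
Qed.

Lemma ln3_gt1 : 1 < ln 3 :> R.
Proof.
rewrite -[X in X < _]expRK ltr_ln ?posrE ?expR_gt0 //.
by rewrite -ltf_pV2 ?posrE ?expR_gt0 // -expRN expRN1_ge.
Qed.

(** The successor of the truncation, rather than the ceiling, keeps [n] positive even at [x = 0]. *)
Lemma natr_ge_exists x : 0 <= x -> exists n : nat, (0 < n)%N /\ x <= n%:R <= x + 1.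
Proof.
move=> x_ge0; exists (Num.truncn x).+1; split=> //.
have /andP[h1 h2] := truncn_itv x_ge0.
by rewrite (ltW h2) /= -natr1 lerD2r.
Qed.

(** Minimality gives [2^e <= N] for [e] one below the logarithm; the remaining 1 is absorbed by
    [ln N], which is at least 1 from [N = 3] on. *)
Lemma up_log_le N : (3 <= N)%N ->
  (up_log 2 N.+1)%:R <= ((ln 2)^-1 + 1) * ln N%:R :> R.
Proof.
move=> N3; have lnN1 : 1 <= ln N%:R :> R.
  by apply: le_trans (ltW ln3_gt1) _; rewrite ler_ln ?posrE ?ltr0n ?ler_nat // (ltn_trans _ N3).
have [e eE] : exists e, up_log 2 N.+1 = e.+1.
  by exists (up_log 2 N.+1).-1; rewrite prednK // up_log_gt0 /= ltnS (leq_trans _ N3).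
have eN : (2 ^ e <= N)%N.
  rewrite -ltnS; have := @up_log_gtn 2 N.+1 isT; rewrite eE; apply.
  by rewrite ltnS (leq_trans _ N3).
have ln2_gt0 : 0 < ln 2 :> R by rewrite ln_gt0 // ltr1n.
rewrite eE -natr1 mulrDl mul1r; apply: lerD => //.
rewrite mulrC ler_pdivlMr // mulr_natl -lnXn // ler_ln ?posrE ?exprn_gt0 //.
  by rewrite -natrX ler_nat.
by rewrite ltr0n (leq_trans _ N3).
Qed.

(** The base collects [r^K] counters per array and about [pv^-K] arrays per group. With [K] near
    [2 ln N / ln (1/Delta)] the exponent of [N] is at most [b1], and the rounding slack [e] costs
    the factor [(r / pv)^e]. *)
Lemma pow_le_race_b1 N r K pv Delta (e : R) :
  (0 < N)%N -> (0 < r)%N -> 0 < pv < 1 -> 0 < Delta < 1 -> 0 <= e ->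
  K%:R <= 2 * ln N%:R / ln Delta^-1 + e ->
  (r%:R / pv) ^+ K <= expR (e * (ln r%:R + `|ln pv|)) * N%:R `^ race_b1 r pv Delta.
Proof.
move=> N_gt0 r_gt0 /andP[pv_gt0 pv_lt1] /andP[D_gt0 D_lt1] e_ge0 KE.
have r1 : 1 <= r%:R :> R by rewrite ler1n.
set a := `|ln pv|; have aE : a = - ln pv by rewrite /a ltr0_norm // ln_lt0 // pv_gt0.
have a_ge0 : 0 <= a by exact: normr_ge0.
have lnr : 0 <= ln r%:R :> R by exact: ln_ge0.
have lnN : 0 <= ln N%:R :> R by rewrite ln_ge0 // ler1n.
have L_gt0 : 0 < ln Delta^-1 by rewrite ln_gt0 // invf_gt1.
have -> : (r%:R / pv) ^+ K = expR (K%:R * (ln r%:R + a)).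
  by rewrite expRM_natl expRD aE expRN !lnK ?posrE ?ltr0n.
rewrite /powR pnatr_eq0 eqn0Ngt N_gt0 /= -expRD ler_expR /race_b1.
apply: le_trans (ler_wpM2r _ KE) _; first exact: addr_ge0.
rewrite mulrDl addrC lerD2l -/a.
rewrite [leLHS](_ : _ = (2 * a + 2 * ln r%:R) / ln Delta^-1 * ln N%:R); last by ring.
rewrite ler_wpM2r // ler_wpM2r ?invr_ge0 ?(ltW L_gt0) // lerD2r.
by rewrite ler_wpM2r // ler_nat.
Qed.

(** The slack [f] covers both roundings of [K]: it is 0 when rounding up and [ln Delta^-1] when
    rounding down. *)
Lemma Delta_pow_le N K Delta (f : R) : (0 < N)%N -> 0 < Delta < 1 ->
  2 * ln N%:R <= K%:R * ln Delta^-1 + f ->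
  Delta ^+ K <= expR f / N%:R ^+ 2.
Proof.
move=> N_gt0 /andP[D_gt0 D_lt1] KE.
have -> : Delta ^+ K = expR (- (K%:R * ln Delta^-1)).
  by rewrite -mulrN expRM_natl expRN lnK ?posrE ?invr_gt0 // invrK.
have -> : expR f / N%:R ^+ 2 = expR (f - 2 * ln N%:R).
  by rewrite expRD expRN expRM_natl lnK // posrE ltr0n.
by rewrite ler_expR; lra.
Qed.

Lemma ln_div_ge_ln3 N delta : (3 <= N)%N -> 0 < delta < 1 ->
  ln 3 <= ln (N%:R / delta) :> R.
Proof.
move=> N3 /andP[delta_gt0 delta_lt1].
have N_gt0 : 0 < N%:R :> R by rewrite ltr0n (leq_trans _ N3).
rewrite ler_ln ?posrE ?divr_gt0 //; apply: le_trans (_ : N%:R <= _); first by rewrite ler_nat.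
by rewrite ler_peMr ?ler0n // ltW // invf_gt1.
Qed.

(** The power of [N] is at least 1. The first bound sizes the groups; the second keeps the logarithm
    of this quantity above a positive constant. *)
Lemma race_log_arg_ge N v delta pv Delta :
  (3 <= N)%N -> (0 < v)%N -> 0 < delta < 1 -> 0 < Delta < 1 ->
  v%:R / delta * ln (N%:R / delta) <=
    v%:R / delta * N%:R `^ race_b2 pv Delta * ln (N%:R / delta) /\
  ln 3 <= v%:R / delta * N%:R `^ race_b2 pv Delta * ln (N%:R / delta).
Proof.
move=> N3 v_gt0 delta_bds /andP[D_gt0 D_lt1].
have /andP[delta_gt0 delta_lt1] := delta_bds.
have ell3 := ln_div_ge_ln3 N3 delta_bds; set ell := ln (N%:R / delta) in ell3 *.
have ell_gt0 : 0 < ell.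
  by apply: lt_le_trans ell3; apply: lt_trans ln3_gt1.
have vd1 : 1 <= v%:R / delta.
  by rewrite ler_pdivlMr // mul1r; apply: le_trans (ltW delta_lt1) _; rewrite ler1n.
have Nb2 : 1 <= N%:R `^ race_b2 pv Delta.
  have N_gt0 : 0 < N%:R :> R by rewrite ltr0n (leq_trans _ N3).
  rewrite /powR gt_eqF // -[leLHS]expR0 ler_expR mulr_ge0 ?ln_ge0 ?ler1n ?(leq_trans _ N3) //.
  by rewrite /race_b2 divr_ge0 ?mulr_ge0 // ln_ge0 // ltW // invf_gt1.
have le1 : v%:R / delta * ell <= v%:R / delta * N%:R `^ race_b2 pv Delta * ell.
  by rewrite ler_wpM2r ?(ltW ell_gt0) // ler_peMr // (le_trans _ vd1).
split=> //; apply: le_trans ell3 _; apply: le_trans le1.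
by rewrite ler_peMl // ltW.
Qed.

(** [K] is left free because the two regimes of the theorem round it differently; all other
    parameters are determined here. *)
Lemma race_params_exist : exists C0 : R, 0 < C0 /\
  forall N r v K delta pv Delta,
  (3 <= N)%N -> (0 < r)%N -> (0 < v < N)%N -> (0 < K)%N ->
  0 < delta < 1 -> 0 < pv < 1 -> 0 < Delta < 1 ->
  N.-1%:R * Delta ^+ K <= 2 / 9 ->
  exists prm : race_params,
    [/\ race_params_pos prm,
        (race_bits N r prm)%:R <= C0 * (v%:R * (r%:R / pv) ^+ K *
           ln (v%:R / delta * N%:R `^ race_b2 pv Delta * ln (N%:R / delta)) *
           ln (N%:R / delta) * ln N%:R) &
        race_solves N r v delta pv Delta prm].
Proof.
(* A lower bound for [ln Q], used to absorb additive constants into a multiple of [ln Q]. *)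
pose kappa : R := ln (ln 3).
have kappa_gt0 : 0 < kappa by rewrite ln_gt0 // ln3_gt1.
pose Cg : R := (270 * ln 18 + 1) / kappa + 270.
pose Cu : R := (ln 2)^-1 + 1.
have ln2_gt0 : 0 < ln 2 :> R by rewrite ln_gt0 // ltr1n.
have ln18_gt0 : 0 < ln 18 :> R by rewrite ln_gt0 // ltr1n.
have Cg_gt0 : 0 < Cg by rewrite addr_gt0 // divr_gt0 // addr_gt0 // mulr_gt0.
have Cu_gt0 : 0 < Cu by rewrite addr_gt0 // invr_gt0.
(* The 18 is 3 from the rows, 3 from the width and 2 from the means. *)
exists (18 * Cg * Cu); split; first by rewrite !mulr_gt0.
move=> N r v K delta pv Delta N3 r_gt0 v_bds K_gt0 delta_bds pv_bds D_bds DK.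
have /andP[v_gt0 vN] := v_bds; have /andP[delta_gt0 delta_lt1] := delta_bds.
have /andP[pv_gt0 pv_lt1] := pv_bds; have /andP[D_gt0 D_lt1] := D_bds.
have N_gt0 : (0 < N)%N by exact: leq_trans N3.
have NR_gt0 : 0 < N%:R :> R by rewrite ltr0n.
have vR1 : 1 <= v%:R :> R by rewrite ler1n.
have dinv1 : 1 <= delta^-1 by rewrite ltW // invf_gt1.
set ell := ln (N%:R / delta).
have ell3 : ln 3 <= ell by exact: ln_div_ge_ln3.
have ell1 : 1 < ell by exact: lt_le_trans ln3_gt1 ell3.
set Q := v%:R / delta * _ * ell.
have [ellQ Q3] : v%:R / delta * ell <= Q /\ ln 3 <= Q by exact: race_log_arg_ge.
have Q_gt0 : 0 < Q by apply: lt_le_trans Q3; exact: lt_trans ln3_gt1.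
have lnQ : kappa <= ln Q by rewrite ler_ln ?posrE // (lt_trans _ ln3_gt1).
have lnQ_gt0 : 0 < ln Q by exact: lt_le_trans lnQ.
have ln2N : ln (2 * (N%:R / delta)) = ln 2 + ell by rewrite lnM ?posrE ?divr_gt0.
have ln2_le1 : ln 2 <= 1 :> R.
  rewrite -[leRHS]expRK ler_ln ?posrE ?expR_gt0 //.
  by apply: le_trans (expR1_ge R); lra.
(* With [d] at least [ln (2N / delta)], the rows fail with probability at most
   [N * expR (- d) <= delta / 2]. *)
have [d [d_gt0 /andP[d_ge d_le]]] :
    exists n : nat, (0 < n)%N /\ ln 2 + ell <= n%:R <= ln 2 + ell + 1.
  by apply: natr_ge_exists; lra.
have d_le3 : d%:R <= 3 * ell by lra.
have dR_gt0 : 0 < d%:R :> R by rewrite ltr0n.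
(* [y] is [2 / delta] times the number [d * 3v] of cells. Since 269/270 is at most [expR (- 1/270)],
   having [270 * ln y] groups brings the total cell failure down to [delta / 2]. *)
pose y := 6 * d%:R * v%:R / delta.
have y_gt0 : 0 < y by rewrite divr_gt0 // !mulr_gt0 // (lt_le_trans _ vR1).
have y_le : y <= 18 * Q.
  apply: le_trans (_ : 18 * (v%:R / delta * ell) <= _); last by rewrite ler_pM2l.
  rewrite /y [leRHS](_ : _ = 6 * (3 * ell) * v%:R / delta); last by ring.
  by rewrite ler_wpM2r ?invr_ge0 ?(ltW delta_gt0) // ler_wpM2r ?ler0n // ler_pM2l.
have y1 : 1 <= y.
  rewrite /y -mulrA -[leLHS]mul1r; apply: ler_pM => //.
    by move: d_gt0; rewrite -(ler1n R); lra.
  by rewrite ler_pdivlMr // mul1r; lra.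
have [g [g_gt0 /andP[g_ge g_le]]] :
    exists n : nat, (0 < n)%N /\ 270 * ln y <= n%:R <= 270 * ln y + 1.
  by apply: natr_ge_exists; rewrite mulr_ge0 // ln_ge0.
have g_leQ : g%:R <= Cg * ln Q.
  apply: le_trans g_le _.
  have : ln y <= ln 18 + ln Q by rewrite -lnM ?posrE // ler_ln ?posrE // mulr_gt0.
  have : 270 * ln 18 + 1 <= (270 * ln 18 + 1) / kappa * ln Q.
    by rewrite mulrAC -mulrA ler_peMr ?addr_ge0 ?mulr_ge0 ?(ltW ln18_gt0) // ler_pdivlMr // mul1r.
  by rewrite /Cg mulrDl; lra.
have pvK_gt0 : 0 < pv ^+ K by rewrite exprn_gt0.
have pvK_le1 : pv ^+ K <= 1 by rewrite exprn_ile1 // ltW.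
have [m [m_gt0 /andP[m_ge m_le]]] :
    exists n : nat, (0 < n)%N /\ (pv ^+ K)^-1 <= n%:R <= (pv ^+ K)^-1 + 1.
  by apply: natr_ge_exists; rewrite invr_ge0 ltW.
have m_le2 : m%:R <= 2 * (pv ^+ K)^-1.
  by apply: le_trans m_le _; rewrite mulrDl mul1r lerD2l invf_ge1.
pose prm := RaceParams K d (3 * v) g m.
have prm_pos : race_params_pos prm.
  by rewrite /race_params_pos /= K_gt0 d_gt0 muln_gt0 v_gt0 g_gt0 m_gt0.
exists prm; split=> //.
  rewrite /race_bits /race_arr !card_prod !card_ord /= !natrM natrX.
  rewrite [leRHS](_ : _ = (3 * ell) * (3 * v%:R) * (Cg * ln Q) * (2 * (pv ^+ K)^-1) *
      r%:R ^+ K * (Cu * ln N%:R)); last by rewrite exprMn exprVn; ring.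
  have up := up_log_le N3.
  have r_ge0 : 0 <= r%:R ^+ K :> R by rewrite exprn_ge0 ?ler0n.
  by repeat (apply: ler_pM; rewrite ?mulr_ge0 ?ler0n //).
apply: race_solves_of_failure_bound => //=.
- by rewrite mulrC -ler_pdivrMl // mulr1.
- by rewrite -ler_pdivlMr.
rewrite (_ : delta = delta / 2 + delta / 2); last by field.
apply: lerD.
  apply: (@le_trans _ _ (N%:R * expR (- (ln 2 + ell)))); last first.
    rewrite -ln2N expRN lnK ?posrE ?mulr_gt0 ?invr_gt0 //.
    by rewrite le_eqVlt; apply/orP; left; apply/eqP; field; rewrite !gt_eqF.
  rewrite ler_pM2l //; apply: (@le_trans _ _ (expR (-1) ^+ d)).
    by apply: lerXn2r; rewrite ?nnegrE ?invr_ge0 ?expR_ge0 ?(ltW expRN1_ge).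
  by rewrite -expRM_natl ler_expR; lra.
apply: (@le_trans _ _ ((d * (3 * v))%:R * expR (- ln y))); last first.
  rewrite expRN lnK ?posrE // /y !natrM le_eqVlt; apply/orP; left; apply/eqP.
  by field; rewrite !gt_eqF // (lt_le_trans _ vR1).
rewrite ler_wpM2l ?ler0n //; apply: (@le_trans _ _ (expR (- 270^-1) ^+ g)).
  apply: lerXn2r; rewrite ?nnegrE ?expR_ge0 //.
  by have := expR_ge1Dx (- 270^-1 : R); lra.
by rewrite -expRM_natl ler_expR; lra.
Qed.

Lemma race_bound_ge N r v K delta pv Delta (e : R) :
  (3 <= N)%N -> (0 < r)%N -> (0 < v)%N ->
  0 < delta < 1 -> 0 < pv < 1 -> 0 < Delta < 1 -> 0 <= e ->
  K%:R <= 2 * ln N%:R / ln Delta^-1 + e ->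
  v%:R * (r%:R / pv) ^+ K *
    ln (v%:R / delta * N%:R `^ race_b2 pv Delta * ln (N%:R / delta)) *
    ln (N%:R / delta) * ln N%:R <=
  expR (e * (ln r%:R + `|ln pv|)) * race_bound N r v delta pv Delta.
Proof.
move=> N3 r_gt0 v_gt0 delta_bds pv_bds D_bds e_ge0 KE.
have N_gt0 : (0 < N)%N by exact: leq_trans N3.
have pow_le := pow_le_race_b1 N_gt0 r_gt0 pv_bds D_bds e_ge0 KE.
have [_ Q3] := race_log_arg_ge pv N3 v_gt0 delta_bds D_bds.
have ell3 := ln_div_ge_ln3 N3 delta_bds; have := ln3_gt1 => ln3.
have lnN : 0 <= ln N%:R :> R by rewrite ln_ge0 // ler1n.
have v1 : 1 <= v%:R :> R by rewrite ler1n.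
have /andP[pv_gt0 _] := pv_bds.
set E := expR _ in pow_le *; set B := _ `^ _ in pow_le.
have key : v%:R * (r%:R / pv) ^+ K <= E * (v%:R ^+ 3 * B).
  rewrite [leRHS]mulrCA; apply: ler_pM => //; last by rewrite exprS ler_peMr ?ler0n // exprn_ege1.
  by rewrite exprn_ge0 // divr_ge0 ?ler0n // ltW.
have ell_ge0 : 0 <= ln (N%:R / delta) by apply: le_trans ell3; lra.
rewrite /race_bound -/B 3![E * _]mulrA; do 2!apply: ler_wpM2r => //.
by apply: ler_wpM2r => //; rewrite ln_ge0 // (le_trans _ Q3) // ltW.
Qed.

End Size.

(** The hidden constant is made precise in two ways: absolute, once [N] is large in terms of
    [Delta]; or depending on [r] and [pv], for every [N] from 3 on. *)
Theorem theorem7 (R : realType) :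
  (exists C : R, 0 < C /\
    forall Delta : R, 0 < Delta < 1 ->
    exists N0 : nat,
    forall (N r v : nat) (delta pv : R),
      (N0 <= N)%N -> (0 < r)%N -> (0 < v < N)%N ->
      0 < delta < 1 -> 0 < pv < 1 ->
      race_constructible C N r v delta pv Delta) /\
  (forall (r : nat) (pv : R), (0 < r)%N -> 0 < pv < 1 ->
    exists C : R, 0 < C /\
    forall (N v : nat) (delta Delta : R),
      (3 <= N)%N -> (0 < v < N)%N ->
      0 < delta < 1 -> 0 < Delta < 1 ->
      race_constructible C N r v delta pv Delta).
Proof.
have [C0 [C0_gt0 paramsP]] := race_params_exist R.
split.
  exists C0; split=> // Delta D_bds; have /andP[D_gt0 D_lt1] := D_bds.
  have L_gt0 : 0 < ln Delta^-1 by rewrite ln_gt0 // invf_gt1.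
  (* [K] is rounded down here, which leaves no factor in [r] and [pv] but only gives
     [N * Delta^K <= 1 / (Delta * N)]; [N >= 5 / Delta] makes this at most 1/5, below 2/9, and also
     forces [K] to be positive. *)
  exists (maxn 3 (Num.truncn (5 / Delta)).+1) => N r v delta pv.
  rewrite geq_max => /andP[N3 N5] r_gt0 v_bds delta_bds pv_bds.
  have N_gt0 : (0 < N)%N by exact: leq_trans N3.
  have ND : 5 / Delta <= N%:R.
    apply: le_trans (ltW (truncnS_gt _)) _; by rewrite ler_nat.
  have ND1 : Delta^-1 <= N%:R.
    by apply: le_trans ND; rewrite ler_peMl ?invr_ge0 ?(ltW D_gt0) // ler1n.
  have LN : ln Delta^-1 <= ln N%:R by rewrite ler_ln ?posrE ?invr_gt0 ?ltr0n.
  pose K := Num.truncn (2 * ln N%:R / ln Delta^-1).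
  have t_ge0 : 0 <= 2 * ln N%:R / ln Delta^-1.
    by rewrite divr_ge0 ?(ltW L_gt0) // mulr_ge0 // ln_ge0 // ler1n.
  have /andP[K_le K_gt] := truncn_itv t_ge0; rewrite -/K in K_le K_gt.
  have K_gt0 : (0 < K)%N.
    rewrite -ltnS -(ltr_nat R); apply: le_lt_trans K_gt.
    by rewrite ler_pdivlMr // mul1r; lra.
  have DK : N.-1%:R * Delta ^+ K <= 2 / 9.
    have h : 2 * ln N%:R <= K%:R * ln Delta^-1 + ln Delta^-1.
      by move: K_gt; rewrite ltr_pdivrMr // -[K.+1%:R]natr1 => h; lra.
    have := Delta_pow_le N_gt0 D_bds h; rewrite lnK ?posrE ?invr_gt0 // => DKle.
    have NR_gt0 : 0 < N%:R :> R by rewrite ltr0n.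
    apply: (@le_trans _ _ (N%:R * (Delta^-1 / N%:R ^+ 2))).
      by apply: ler_pM; rewrite ?ler0n ?exprn_ge0 ?(ltW D_gt0) ?ler_nat ?leq_pred.
    rewrite [leLHS](_ : _ = Delta^-1 / N%:R); last by field; rewrite !gt_eqF.
    by rewrite ler_pdivrMr //; lra.
  have [prm [prm_pos bits solves]] :=
    paramsP N r v K delta pv Delta N3 r_gt0 v_bds K_gt0 delta_bds pv_bds D_bds DK.
  exists prm; split=> //; last by move=> X l h; exact: race_cms_one_pass.
  apply: le_trans bits _; rewrite ler_pM2l //; have /andP[v_gt0 _] := v_bds.
  have K_le0 : K%:R <= 2 * ln N%:R / ln Delta^-1 + 0 by rewrite addr0.
  have := race_bound_ge N3 r_gt0 v_gt0 delta_bds pv_bds D_bds (lexx 0) K_le0.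
  by rewrite mul0r expR0 mul1r.
(* Now [K] is rounded up; the extra factor [r / pv] goes into the constant. *)
move=> r pv r_gt0 pv_bds; exists (C0 * expR (1 * (ln r%:R + `|ln pv|))).
split; first by rewrite mulr_gt0 // expR_gt0.
move=> N v delta Delta N3 v_bds delta_bds D_bds; have /andP[D_gt0 D_lt1] := D_bds.
have N_gt0 : (0 < N)%N by exact: leq_trans N3.
have L_gt0 : 0 < ln Delta^-1 by rewrite ln_gt0 // invf_gt1.
have [K [K_gt0 /andP[K_ge K_le]]] : exists n : nat, (0 < n)%N /\
    2 * ln N%:R / ln Delta^-1 <= n%:R <= 2 * ln N%:R / ln Delta^-1 + 1.
  apply: natr_ge_exists.
  by rewrite divr_ge0 ?(ltW L_gt0) // mulr_ge0 // ln_ge0 // ler1n.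
have DK : N.-1%:R * Delta ^+ K <= 2 / 9.
  have h : 2 * ln N%:R <= K%:R * ln Delta^-1 + 0 by rewrite addr0 -ler_pdivrMr.
  have := Delta_pow_le N_gt0 D_bds h; rewrite expR0 => DKle.
  have N3R : 3 <= N%:R :> R by rewrite ler_nat.
  (* At [N = 3] this value is exactly 2/9. *)
  apply: (@le_trans _ _ (N.-1%:R * (1 / N%:R ^+ 2))); first by rewrite ler_wpM2l ?ler0n.
  rewrite mulrA mulr1 ler_pdivrMr ?exprn_gt0 ?ltr0n //.
  have -> : N%:R = N.-1%:R + 1 :> R by rewrite natr1 prednK.
  have : 2 <= N.-1%:R :> R by rewrite ler_nat -ltnS prednK.
  move: (N.-1%:R) => n n2.
  (* This product equals [2 * (n + 1)^2 - 9 * n]. *)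
  have : 0 <= (n - 2) * (2 * n - 1) by apply: mulr_ge0; lra.
  by lra.
have [prm [prm_pos bits solves]] :=
  paramsP N r v K delta pv Delta N3 r_gt0 v_bds K_gt0 delta_bds pv_bds D_bds DK.
exists prm; split=> //; last by move=> X l h; exact: race_cms_one_pass.
apply: le_trans bits _; rewrite -[leRHS]mulrA ler_pM2l //; have /andP[v_gt0 _] := v_bds.
exact: race_bound_ge.
Qed.
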